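(* There is an absolute constant $c>0$ such that the following holds. For every integer $n\ge 4$ and every pair of weight functions $w,u:[n]^{(2)}\to\mathbb R$, we have $$\operatorname{disc}^+(w,u)\,\operatorname{disc}^-(w,u)\ge c\bigl(n^4J_1(w,u)^2+n^3J_2(w,u)^2\bigr).$$ In particular, $$\operatorname{disc}(w,u)\ge c\bigl(n^2J_1(w,u)+n^{3/2}J_2(w,u)\bigr).$$
   Context: Write $[n]=\{1,\dots,n\}$ and let $[n]^{(2)}=\{(x,y)\in[n]\times[n]:x\ne y\}$ be the set of ordered pairs of distinct vertices. For weight functions $w,u:[n]^{(2)}\to\mathbb R$ put $\langle w,u\rangle=\sum_{x\ne y}w_{xy}u_{xy}$, $w([n])=\sum_{x\ne y}w_{xy}$ and $d(w)=w([n])/(n(n-1))$. For $\pi\in S_n$ the relabelling $w_\pi$ is $(w_\pi)_{xy}=w_{\pi^{-1}(x)\pi^{-1}(y)}$. Define $$\operatorname{disc}^+(w,u)=\max_{\pi\in S_n}\langle w_\pi,u\rangle-d(w)d(u)n(n-1),\qquad \operatorname{disc}^-(w,u)=d(w)d(u)n(n-1)-\min_{\pi\in S_n}\langle w_\pi,u\rangle,$$ and $\operatorname{disc}(w,u)=\max\{\operatorname{disc}^+(w,u),\operatorname{disc}^-(w,u)\}$. For $x\in[n]$ let $r_x(w)=\sum_{y\ne x}w_{xy}$, $c_x(w)=\sum_{y\ne x}w_{yx}$, and $$p_x(w)=\frac{r_x(w)+c_x(w)}{2(n-2)},\qquad q_x(w)=\frac{r_x(w)-c_x(w)}{2n}.$$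 For an ordered pair $a\ne b$ define $$\Phi_1^w(a,b)=\Bigl(\sqrt{\tfrac{2(n-2)}{n}}\,(p_a(w)-p_b(w)),\ \sqrt2\,(q_a(w)-q_b(w))\Bigr)\in\mathbb R^2.$$ For an ordered quadruple $Q=(a,b;c,d)$ of distinct vertices let $C_w(Q)=w_{ac}-w_{bc}-w_{ad}+w_{bd}$, $Q^{\mathsf T}=(c,d;a,b)$, and $$\Phi_2^w(Q)=\tfrac12\bigl(C_w(Q)+C_w(Q^{\mathsf T}),\ C_w(Q)-C_w(Q^{\mathsf T})\bigr)\in\mathbb R^2.$$ Define $$J_1(w,u)=\mathbb E\,\bigl|\langle\Phi_1^w(a,b),\Phi_1^u(c,d)\rangle\bigr|,\qquad J_2(w,u)=\mathbb E\,\bigl|\langle\Phi_2^w(Q),\Phi_2^u(Q')\rangle\bigr|,$$ where $\langle\cdot,\cdot\rangle$ is the standard inner product on $\mathbb R^2$; in $J_1$ the ordered pairs $(a,b)$ and $(c,d)$ are chosen independently and uniformly from all ordered pairs of distinct vertices of $[n]$, and in $J_2$ the ordered quadruples $Q,Q'$ are chosen independently and uniformly from all ordered quadruples of distinct vertices of $[n]$. *)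

(* Defs.v *)
From mathcomp Require Import all_boot all_order all_algebra all_fingroup.
From mathcomp Require Import reals exp.
Set Implicit Arguments.
Unset Strict Implicit.
Unset Printing Implicit Defensive.
Import Order.TTheory GRing.Theory Num.Theory.
Local Open Scope ring_scope.

Section Discrepancy.
Variables (R : realType) (n : nat).

(* A weight function on ordered pairs of distinct vertices is represented by a
   total function; none of the definitions below reads its diagonal values. *)
Definition weight := 'I_n -> 'I_n -> R.

Implicit Types w u : weight.

Definition pairing w u : R := \sum_(x < n) \sum_(y < n | y != x) w x y * u x y.

Definition total w : R := \sum_(x < n) \sum_(y < n | y != x) w x y.

Definition density w : R := total w / (n%:R * (n%:R - 1)).

Definition relabel (s : 'S_n) w : weight :=
  fun x y => w ((s^-1)%g x) ((s^-1)%g y).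

(* The neutral value of the two big operators is the term of the identity
   permutation, so that they are the maximum and the minimum over 'S_n. *)
Definition max_pairing w u : R :=
  \big[Num.max/pairing (relabel 1%g w) u]_(s : 'S_n) pairing (relabel s w) u.

Definition min_pairing w u : R :=
  \big[Num.min/pairing (relabel 1%g w) u]_(s : 'S_n) pairing (relabel s w) u.

Definition disc_plus w u : R :=
  max_pairing w u - density w * density u * (n%:R * (n%:R - 1)).

Definition disc_minus w u : R :=
  density w * density u * (n%:R * (n%:R - 1)) - min_pairing w u.

Definition disc w u : R := Num.max (disc_plus w u) (disc_minus w u).

Definition out_sum w (x : 'I_n) : R := \sum_(y < n | y != x) w x y.
Definition in_sum w (x : 'I_n) : R := \sum_(y < n | y != x) w y x.

Definition p_coef w (x : 'I_n) : R :=
  (out_sum w x + in_sum w x) / (2 * (n%:R - 2)).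
Definition q_coef w (x : 'I_n) : R :=
  (out_sum w x - in_sum w x) / (2 * n%:R).

Definition dot (v v' : R * R) : R := v.1 * v'.1 + v.2 * v'.2.

Definition Phi1 w (e : 'I_n * 'I_n) : R * R :=
  (Num.sqrt (2 * (n%:R - 2) / n%:R) * (p_coef w e.1 - p_coef w e.2),
   Num.sqrt 2 * (q_coef w e.1 - q_coef w e.2)).

(* The quadruple (a, b; c, d) is encoded as the pair of pairs ((a, b), (c, d)). *)
Definition quad : Type := (('I_n * 'I_n) * ('I_n * 'I_n))%type.

Definition quad_tr (Q : quad) : quad := (Q.2, Q.1).

Definition Cquad w (Q : quad) : R :=
  let: ((a, b), (c, d)) := Q in w a c - w b c - w a d + w b d.

Definition Phi2 w (Q : quad) : R * R :=
  (2^-1 * (Cquad w Q + Cquad w (quad_tr Q)),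
   2^-1 * (Cquad w Q - Cquad w (quad_tr Q))).

Definition distinct_pairs : {set 'I_n * 'I_n} := [set e | e.1 != e.2].

Definition distinct_quads : {set ('I_n * 'I_n) * ('I_n * 'I_n)} :=
  [set Q | uniq [:: Q.1.1; Q.1.2; Q.2.1; Q.2.2]].

(* Expectation of f at a uniformly random element of A. *)
Definition unif_mean (T : finType) (A : {set T}) (f : T -> R) : R :=
  (\sum_(t in A) f t) / #|A|%:R.

(* Two independent uniform choices are one uniform choice from the product. *)
Definition J1 w u : R :=
  unif_mean (setX distinct_pairs distinct_pairs)
    (fun z => `|dot (Phi1 w z.1) (Phi1 u z.2)|).

Definition J2 w u : R :=
  unif_mean (setX distinct_quads distinct_quads)
    (fun z => `|dot (Phi2 w z.1) (Phi2 u z.2)|).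

End Discrepancy.

(* Main.v *)
Require Import Defs.
From mathcomp Require Import all_boot all_order all_algebra all_fingroup.
From mathcomp Require Import reals exp.
From mathcomp Require Import ring lra.
Import Order.TTheory GRing.Theory Num.Theory.
Local Open Scope ring_scope.

(** Take [s, r] independent and uniform in [S_n], so that the centred overlap [F]
of [w] relabelled by [s] and [u] relabelled by [r] has mean zero and lies between
[- disc_minus] and [disc_plus].  Fix [k = n %/ 4] disjoint position pairs
[{a_i, b_i}] and tilt the uniform measure by [prod_i (1 + x * s_i)], [|x| <= 1],
where [|s_i| <= 1], [s_i] changes sign when [r] is modified by swapping [a_i] and
[b_i], and [s_i] is unaffected by the other swaps.  Every term of [F] involves at
most two of the pairs, so the tilted mean of [F] is a quadratic [A x + B x^2]
whatever [k] is; a quadratic with values in [[-D^-, D^+]] on [[-1, 1]] satisfies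
[A^2 <= 4 D^+ D^-].  It remains to choose the [s_i] so that [A = E (sum_i s_i) F]
is large.

For [J1] let [s_i] be half the difference of the signs of
[<Psi^w(s a_i), Psi^u(r a_i)>] and [<Psi^w(s a_i), Psi^u(r b_i)>], where [Psi] is
the one-vertex vector of which [Phi1] is the difference: the mean of [F] given
[s a_i = x], [r a_i = y] is a multiple of [<Psi^w x, Psi^u y>].

For [J2] use [k] further pairs [{c_j, d_j}] and let [s_i] be the sign of
[sum_j Y_ij], where [Y_ij] is the product of the [Phi2] vectors of the images of
[(a_i, b_i; c_j, d_j)]: the second difference of [F] with respect to swapping
[{a_i, b_i}] and swapping all the [{c_j, d_j}] is [2 sum_j Y_ij].  The [Y_ij]
have independent random signs, so Khinchine's inequality gives
[E |sum_j Y_ij| >= sqrt (k / 3) J2]. *)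

Set Implicit Arguments.
Unset Strict Implicit.
Unset Printing Implicit Defensive.

(** * Elementary sums and quadratics *)

Lemma sum_odd (R : realDomainType) (T : finType) (h : T -> T) (g : T -> R) :
  involutive h -> (forall t, g (h t) = - g t) -> \sum_t g t = 0.
Proof.
move=> hK g_odd; have : \sum_t g t = - \sum_t g t.
  rewrite {1}(reindex_inj (inv_inj hK)) -sumrN.
  by apply: eq_bigr => t _; rewrite g_odd.
lra.
Qed.

Lemma sum_support_inj (R : nmodType) (I J : finType) (f : I -> J) (g : J -> R) :
  injective f -> (forall y, (forall x, y != f x) -> g y = 0) ->
  \sum_y g y = \sum_x g (f x).
Proof.
move=> f_inj g_supp; rewrite (bigID (mem (f @: setT))) /=.
rewrite [X in _ + X]big1 ?addr0.
  by rewrite big_imset; [apply: eq_bigl => x; rewrite inE | move=> x y _ _ /f_inj].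
move=> y yNf; apply: g_supp => x; apply: contra yNf => /eqP ->.
by apply: imset_f; rewrite inE.
Qed.

(** If [|A| > 2 * |B|], the endpoints give [|A| / 2] below both [a] and [b]. Otherwise the vertex
    lies in the interval: its value [- A^2 / (4 B)] is controlled by one bound, and the endpoints
    control [|B|] by the other. *)
Lemma quadratic_range (R : realFieldType) (A B a b : R) :
  (forall x, -1 <= x -> x <= 1 -> x * A + x ^+ 2 * B <= a /\
     - b <= x * A + x ^+ 2 * B) -> A ^+ 2 <= 4 * (a * b).
Proof.
move=> H.
have [H0a H0b] : 0 <= a /\ 0 <= b by have := H 0; nra.
have [[Hpa Hpb] [Hma Hmb]] : (A + B <= a /\ - b <= A + B) /\
   (- A + B <= a /\ - b <= - A + B) by have := H 1; have := H (-1); nra.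
have [AB|AB] := lerP (`|A|) (2 * `|B|); last first.
  have [E1 E2] : `|A| / 2 <= a /\ `|A| / 2 <= b.
    move: AB; case: (ger0P A) => ?; case: (ger0P B) => ?; lra.
  by rewrite -real_normK ?num_real //; have := normr_ge0 A; nra.
have [B0|B0] := eqVneq B 0.
  by move: AB; rewrite B0 normr0 mulr0 normr_le0 => /eqP ->; nra.
set x := - A / (2 * B).
have x1 : `|x| <= 1.
  have nB : 0 < `|B| by rewrite normr_gt0.
  have -> : `|x| = `|A| / (2 * `|B|).
    by rewrite /x normrM normrN normfV normrM (ger0_norm (_ : 0 <= 2)).
  by rewrite ler_pdivrMr ?mul1r // mulr_gt0.
have [] := H x; [by move: x1; rewrite ler_norml => /andP[] |
  by move: x1; rewrite ler_norml => /andP[] |].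
have -> : x * A + x ^+ 2 * B = - (A ^+ 2 / (4 * B)) by rewrite /x; field.
have [Bp|Bn] := ltP 0 B => E1 E2.
  have : A ^+ 2 <= b * (4 * B) by rewrite -ler_pdivrMr; lra.
  have : B <= a by move: AB; case: (ger0P A) => ?; lra.
  nra.
have Bn' : B < 0 by rewrite lt_neqAle B0.
have : A ^+ 2 <= a * (4 * - B).
  by rewrite -ler_pdivrMr ?mulrN ?invrN ?mulrN //; lra.
have : - B <= b by move: AB; case: (ger0P A) => ?; lra.
nra.
Qed.

(** * Tilts and random signs *)

Section Tilt.
Variables (R : realFieldType) (T I : finType).
Variables (th : I -> T -> T) (s : I -> T -> R).
Hypothesis thK : forall i, involutive (th i).
Hypothesis s_odd : forall i t, s i (th i t) = - s i t.
Hypothesis s_even : forall i j t, i != j -> s j (th i t) = s j t.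

Let tilt x t := \prod_i (1 + x * s i t).

(** Factors are removed one at a time: the term carrying [s i] is odd under [th i], since [g] and
    the remaining factors are invariant. *)
Lemma sum_tilt_invariant (P : pred I) (g : T -> R) x :
  (forall i t, P i -> g (th i t) = g t) ->
  \sum_t (\prod_(i | P i) (1 + x * s i t)) * g t = \sum_t g t.
Proof.
(* Without repetitions in the list, every factor still present has an index other than [i], so
   [s_even] applies to it. *)
move=> g_inv; have : uniq (index_enum I) by exact: index_enum_uniq.
elim: (index_enum I) => [_|i r IHr] /=.
  by apply: eq_bigr => t _; rewrite big_nil mul1r.
case/andP=> iNr /IHr {}IHr.
have [Pi|PiN] := boolP (P i); last first.
  by rewrite -[RHS]IHr; apply: eq_bigr => t _; rewrite big_cons (negPf PiN).
rewrite -[RHS]IHr.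
under eq_bigr do rewrite big_cons Pi.
under eq_bigr do rewrite -mulrA mulrDl mul1r.
rewrite big_split /= [X in _ + X](_ : _ = 0) ?addr0 //.
apply: (@sum_odd _ _ (th i)) => // t.
rewrite s_odd g_inv // mulrN mulNr; congr (- (_ * (_ * _))).
rewrite big_seq_cond [RHS]big_seq_cond; apply: eq_bigr => j /andP[jr _].
by rewrite s_even //; apply: contraNneq iNr => ->.
Qed.

(** The linear coefficient is prescribed, being the quantity to be bounded; [B] is left free because
    [quadratic_range] is uniform in it. *)
Definition quadratic_tilt (g : T -> R) := exists B, forall x,
  \sum_t tilt x t * g t =
  \sum_t g t + x * (\sum_t (\sum_i s i t) * g t) + x ^+ 2 * B.

Lemma quadratic_tilt_sum (J : Type) (r : seq J) (P : pred J) (f : J -> T -> R) :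
  (forall j, P j -> quadratic_tilt (f j)) ->
  quadratic_tilt (fun t => \sum_(j <- r | P j) f j t).
Proof.
move=> Hf; elim: r => [|j r [B HB]].
  exists 0 => x.
  by rewrite mulr0 addr0 !(big1, mulr0, addr0) // => t _; rewrite big_nil ?mulr0.
have [Pj|PjN] := boolP (P j); last first.
  exists B => x; under eq_bigr do rewrite big_cons (negPf PjN).
  rewrite HB; congr (_ + _ * _ + _); apply: eq_bigr => t _;
  by rewrite big_cons (negPf PjN).
have [C HC] := Hf j Pj; exists (C + B) => x.
under eq_bigr do rewrite big_cons Pj mulrDr.
rewrite big_split /= HB HC.
under [X in _ = X + _ + _]eq_bigr do rewrite big_cons Pj.
under [X in _ = _ + _ * X + _]eq_bigr do rewrite big_cons Pj mulrDr.
by rewrite !big_split /=; ring.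
Qed.

(** All factors except those of [i1] and [i2] average out, leaving
    [(1 + x * s i1) * (1 + x * s i2) * g], or a single factor if the two indices coincide. *)
Lemma quadratic_tilt_local (g : T -> R) i1 i2 :
  (forall i t, i != i1 -> i != i2 -> g (th i t) = g t) -> quadratic_tilt g.
Proof.
move=> g_inv.
have lin0 i : i != i1 -> i != i2 -> \sum_t s i t * g t = 0.
  move=> h1 h2; apply: (@sum_odd _ _ (th i)) => // t.
  by rewrite s_odd g_inv // mulNr.
have linE : \sum_t (\sum_i s i t) * g t = \sum_i \sum_t s i t * g t.
  by rewrite exchange_big; apply: eq_bigr => t _; rewrite mulr_suml.
have [e|ne] := eqVneq i1 i2.
  rewrite -{}e in g_inv lin0.
  exists 0 => x; rewrite mulr0 addr0 linE.
  rewrite [X in x * X](bigD1 i1) //= [X in _ + x * (_ + X)]big1 ?addr0; last first.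
    by move=> i h; exact: (lin0 i h h).
  rewrite -(@sum_tilt_invariant (fun i => i != i1) g x); last first.
    by move=> i t h; exact: (g_inv i t h h).
  rewrite -(@sum_tilt_invariant (fun i => i != i1) (fun t => s i1 t * g t) x);
    last by move=> i t h; rewrite s_even ?(g_inv _ _ h h) // eq_sym.
  rewrite mulr_sumr -big_split /=; apply: eq_bigr => t _.
  by rewrite /tilt (bigD1 i1) //=; ring.
exists (\sum_t s i1 t * s i2 t * g t) => x.
rewrite linE [X in x * X](bigD1 i1) //= [X in x * (_ + X)](bigD1 i2) 1?eq_sym //=.
rewrite [X in x * (_ + (_ + X))]big1 ?addr0; last first.
  by move=> i /andP[]; exact: lin0.
pose P i := (i != i1) && (i != i2).
(* Inserting the product over [P] into every sum reduces the claim to a pointwise identity. *)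
have inv h : (forall i t, P i -> h (th i t) = h t) ->
  \sum_t h t = \sum_t (\prod_(i | P i) (1 + x * s i t)) * h t.
  by move=> ?; rewrite sum_tilt_invariant.
rewrite (inv g) ?(inv (fun t => s i1 t * g t)) ?(inv (fun t => s i2 t * g t))
  ?(inv (fun t => s i1 t * s i2 t * g t)); first last.
- by move=> i t /andP[h1 h2]; exact: g_inv.
- by move=> i t /andP[h1 h2]; rewrite s_even // g_inv.
- by move=> i t /andP[h1 h2]; rewrite s_even // g_inv.
- by move=> i t /andP[h1 h2]; rewrite !s_even // g_inv.
rewrite mulrDr !mulr_sumr -!big_split /=; apply: eq_bigr => t _.
rewrite /tilt (bigD1 i1) //= (bigD1 i2) 1?eq_sym //= -/(P _).
by ring.
Qed.

(** For [|x| <= 1] the tilt is a nonnegative weight of total mass [#|T|], so the tilted sum of [g]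
    stays between [- #|T| * b] and [#|T| * a]. *)
Lemma tilt_range (g : T -> R) a b : quadratic_tilt g -> \sum_t g t = 0 ->
  (forall i t, `|s i t| <= 1) -> (forall t, - b <= g t <= a) ->
  (\sum_t (\sum_i s i t) * g t) ^+ 2 <= 4 * (a * b) * #|T|%:R ^+ 2.
Proof.
move=> [B HB] g0 s1 gab.
suff : (\sum_t (\sum_i s i t) * g t) ^+ 2 <= 4 * ((#|T|%:R * a) * (#|T|%:R * b)).
  by congr (_ <= _); ring.
apply: (@quadratic_range _ _ B) => x xl xu.
have tilt0 t : 0 <= tilt x t.
  apply: prodr_ge0 => i _; have := s1 i t; rewrite ler_norml => /andP[]; nra.
have tilt1 : \sum_t tilt x t = #|T|%:R.
  have := @sum_tilt_invariant predT (fun=> 1) x (fun _ _ _ => erefl).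
  rewrite sumr_const -/(tilt x) => <-.
  by apply: eq_bigr => t _; rewrite mulr1.
have -> : x * (\sum_t (\sum_i s i t) * g t) + x ^+ 2 * B = \sum_t tilt x t * g t.
  by rewrite HB g0 add0r.
rewrite -tilt1 -mulrN !mulr_suml; split; apply: ler_sum => t _;
  by apply: ler_wpM2l => //; have /andP[] := gab t.
Qed.
End Tilt.

Lemma sqr_sum_le (R : realDomainType) (I : finType) (x : I -> R) :
  (\sum_i `|x i|) ^+ 2 <= #|I|%:R * \sum_i x i ^+ 2.
Proof.
have : 0 <= \sum_i \sum_j (`|x i| - `|x j|) ^+ 2.
  by apply: sumr_ge0 => i _; apply: sumr_ge0 => j _; exact: sqr_ge0.
have -> : \sum_i \sum_j (`|x i| - `|x j|) ^+ 2 =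
    2 * (#|I|%:R * \sum_i x i ^+ 2) - 2 * (\sum_i `|x i|) ^+ 2.
  transitivity (\sum_i (#|I|%:R * x i ^+ 2 + \sum_j x j ^+ 2
      - 2 * (`|x i| * \sum_j `|x j|))).
    apply: eq_bigr => i _; rewrite !mulr_sumr.
    under eq_bigr do rewrite sqrrB !real_normK ?num_real // addrAC.
    rewrite sumrB big_split /= sumr_const mulr_natl; congr (_ - _).
    by apply: eq_bigr => j _; rewrite mulr_natl.
  rewrite sumrB big_split /= sumr_const -!mulr_sumr -mulr_suml -mulr_natl.
  by ring.
lra.
Qed.

Section Khinchine.
Variables (R : rcfType) (T I : finType).
Variables (ph : I -> T -> T) (Y : I -> T -> R).
Hypothesis phK : forall i, involutive (ph i).
Hypothesis Y_odd : forall i t, Y i (ph i t) = - Y i t.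
Hypothesis Y_even : forall i j t, i != j -> Y j (ph i t) = Y j t.

Let X r t := \sum_(i <- r) Y i t.
Let V r t := \sum_(i <- r) Y i t ^+ 2.

(** Induction on [r], with terms odd in [Y i] cancelling. The weight [h] is general so that the
    hypothesis can be reused with [h * Y i ^+ 2]; the constant 3 makes [3 * V^2] reproduce the cross
    term with coefficient 6. *)
Lemma sign_moments (r : seq I) (h : T -> R) : uniq r ->
  (forall t, 0 <= h t) -> (forall i t, h (ph i t) = h t) ->
  \sum_t h t * X r t ^+ 2 = \sum_t h t * V r t /\
  \sum_t h t * X r t ^+ 4 <= 3 * \sum_t h t * V r t ^+ 2.
Proof.
elim: r h => [|i r IHr] h /=.
  move=> _ _ _; split.
    by apply: eq_bigr => t _; rewrite /X /V !big_nil expr0n.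
  rewrite mulr_sumr; apply: ler_sum => t _.
  by rewrite /X /V !big_nil !expr0n /= !mulr0.
case/andP=> iNr r_uniq h0 h_inv.
have [E2 E4] := IHr h r_uniq h0 h_inv.
have Y2_inv j t : Y i (ph j t) ^+ 2 = Y i t ^+ 2.
  have [->|ne] := eqVneq j i; first by rewrite Y_odd sqrrN.
  by rewrite Y_even.
have F2 : \sum_t (h t * Y i t ^+ 2) * X r t ^+ 2 =
   \sum_t (h t * Y i t ^+ 2) * V r t.
  have [] // := IHr (fun t => h t * Y i t ^+ 2) r_uniq.
    by move=> t; rewrite mulr_ge0 ?sqr_ge0.
  by move=> j t; rewrite h_inv Y2_inv.
have X_inv t : X r (ph i t) = X r t.
  rewrite /X; apply: eq_big_seq => j jr; apply: Y_even.
  by apply: contraNneq iNr => ->.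
have XE t : X (i :: r) t = Y i t + X r t by rewrite /X big_cons.
have VE t : V (i :: r) t = Y i t ^+ 2 + V r t by rewrite /V big_cons.
have odd1 : \sum_t 2 * (h t * (Y i t * X r t)) = 0.
  by apply: (@sum_odd _ _ (ph i)) => // t; rewrite h_inv X_inv Y_odd; ring.
have odd3 : \sum_t 4 * (h t * (Y i t ^+ 3 * X r t + Y i t * X r t ^+ 3)) = 0.
  by apply: (@sum_odd _ _ (ph i)) => // t; rewrite h_inv X_inv Y_odd; ring.
split.
  transitivity (\sum_t h t * X r t ^+ 2 + \sum_t 2 * (h t * (Y i t * X r t)) +
      \sum_t h t * Y i t ^+ 2).
    by rewrite -!big_split /=; apply: eq_bigr => t _; rewrite XE; ring.
  rewrite odd1 addr0 E2 -big_split /=; apply: eq_bigr => t _.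
  by rewrite VE; ring.
have -> : \sum_t h t * X (i :: r) t ^+ 4 = \sum_t h t * X r t ^+ 4 +
   6 * (\sum_t (h t * Y i t ^+ 2) * X r t ^+ 2) + \sum_t h t * Y i t ^+ 4 +
   \sum_t 4 * (h t * (Y i t ^+ 3 * X r t + Y i t * X r t ^+ 3)).
  rewrite mulr_sumr -!big_split /=; apply: eq_bigr => t _.
  by rewrite XE; ring.
rewrite odd3 addr0 F2.
have -> : 3 * (\sum_t h t * V (i :: r) t ^+ 2) = 3 * (\sum_t h t * V r t ^+ 2) +
   6 * (\sum_t (h t * Y i t ^+ 2) * V r t) + 3 * \sum_t h t * Y i t ^+ 4.
  rewrite !mulr_sumr -!big_split /=; apply: eq_bigr => t _.
  by rewrite VE; ring.
have : 0 <= \sum_t h t * Y i t ^+ 4.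
  by apply: sumr_ge0 => t _; rewrite mulr_ge0 // (exprM _ 2 2) sqr_ge0.
by move: E4; lra.
Qed.

(** The weights [l^-1] and [l^-3] are invariant under sign changes, so [sign_moments] applies to a
    quartic minorant of [|X|]. The choice [l^2 = 3 V] maximises the resulting bound, which is
    [l / 3]. *)
Lemma khinchine :
  \sum_t Num.sqrt (\sum_i Y i t ^+ 2) <= Num.sqrt 3 * \sum_t `|\sum_i Y i t|.
Proof.
set r := index_enum I; pose l t := Num.sqrt (3 * V r t).
have V0 t : 0 <= V r t by apply: sumr_ge0 => i _; exact: sqr_ge0.
have l0 t : 0 <= l t by exact: sqrtr_ge0.
have l2 t : l t ^+ 2 = 3 * V r t by rewrite sqr_sqrtr // mulr_ge0.
have l_inv i t : l (ph i t) = l t.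
  congr (Num.sqrt (_ * _)); apply: eq_bigr => j _.
  have [->|ne] := eqVneq i j; first by rewrite Y_odd sqrrN.
  by rewrite Y_even.
have r_uniq : uniq r by exact: index_enum_uniq.
have E2 : \sum_t (l t)^-1 * X r t ^+ 2 = \sum_t (l t)^-1 * V r t.
  have [] // := @sign_moments r (fun t => (l t)^-1) r_uniq => [t|i t].
    by rewrite invr_ge0.
  by rewrite l_inv.
have E4 : \sum_t (l t)^-1 ^+ 3 * X r t ^+ 4 <=
    3 * \sum_t (l t)^-1 ^+ 3 * V r t ^+ 2.
  have [] // := @sign_moments r (fun t => (l t)^-1 ^+ 3) r_uniq => [t|i t].
    by rewrite exprn_ge0 // invr_ge0.
  by rewrite l_inv.
(* The polynomial minorant [(3 z^2 - z^4) / 2 <= |z|] at [z = X / l], where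
   [l^2 = 3 V]; it stays valid when [l = 0], as then [l^-1 = 0]. *)
have ptw t : (3 * ((l t)^-1 * X r t ^+ 2) - (l t)^-1 ^+ 3 * X r t ^+ 4) / 2
     <= `|X r t|.
  have [z|nz] := eqVneq (l t) 0.
    by rewrite z invr0 expr0n /= !mul0r mulr0 subr0 mul0r.
  have lp : 0 < l t by rewrite lt_def nz l0.
  set z := `|X r t| / l t.
  have z0 : 0 <= z by rewrite divr_ge0.
  have -> : `|X r t| = l t * z by rewrite /z mulrC divfK.
  have -> : (3 * ((l t)^-1 * X r t ^+ 2) - (l t)^-1 ^+ 3 * X r t ^+ 4) / 2
     = l t * ((3 * z ^+ 2 - z ^+ 4) / 2).
    have X2 : X r t ^+ 2 = `|X r t| ^+ 2 by rewrite real_normK ?num_real.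
    by rewrite (exprM _ 2 2) X2 /z; field.
  rewrite ler_pM2l //.
  (* This product equals [z^4 - 3 z^2 + 2 z], twice the gap between [z] and its minorant. *)
  have : 0 <= z * ((z - 1) ^+ 2 * (z + 2)).
    by rewrite mulr_ge0 // mulr_ge0 ?sqr_ge0 // addr_ge0.
  lra.
have sV t : Num.sqrt (V r t) = l t / Num.sqrt 3.
  by rewrite /l sqrtrM // (mulrC (Num.sqrt 3)) mulfK // sqrtr_eq0 -ltNge.
have s3 : 0 < Num.sqrt 3 :> R by rewrite sqrtr_gt0.
have s32 : Num.sqrt 3 ^+ 2 = 3 :> R by rewrite sqr_sqrtr.
have : \sum_t (3 * ((l t)^-1 * X r t ^+ 2) - (l t)^-1 ^+ 3 * X r t ^+ 4) / 2
   <= \sum_t `|X r t| by apply: ler_sum => t _; exact: ptw.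
rewrite -mulr_suml sumrB -mulr_sumr E2.
have -> : \sum_t (l t)^-1 * V r t = (\sum_t l t) / 3.
  rewrite mulr_suml; apply: eq_bigr => t _.
  have [z|nz] := eqVneq (l t) 0; first by rewrite z invr0 !mul0r.
  have -> : V r t = l t ^+ 2 / 3 by rewrite l2; field.
  by field.
move: E4; have -> : \sum_t (l t)^-1 ^+ 3 * V r t ^+ 2 = (\sum_t l t) / 9.
  rewrite mulr_suml; apply: eq_bigr => t _.
  have [z|nz] := eqVneq (l t) 0; first by rewrite z invr0 expr0n /= !mul0r.
  have -> : V r t = l t ^+ 2 / 3 by rewrite l2; field.
  by field.
have -> : \sum_t Num.sqrt (V r t) = (\sum_t l t) / Num.sqrt 3.
  by rewrite mulr_suml; apply: eq_bigr => t _.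
move=> E4 E; rewrite ler_pdivrMr // mulrAC -expr2 s32.
by move: E4 E; rewrite /X; lra.
Qed.

Lemma khinchine_l1 :
  (\sum_t \sum_i `|Y i t|) ^+ 2 <= 3 * #|I|%:R * (\sum_t `|\sum_i Y i t|) ^+ 2.
Proof.
have cs t : \sum_i `|Y i t| <= Num.sqrt #|I|%:R * Num.sqrt (\sum_i Y i t ^+ 2).
  rewrite -sqrtrM ?ler0n // -[leLHS]ger0_norm ?sumr_ge0 // -sqrtr_sqr.
  by rewrite ler_wsqrtr // sqr_sum_le.
have sY : \sum_t \sum_i `|Y i t| <=
    Num.sqrt #|I|%:R * (Num.sqrt 3 * \sum_t `|\sum_i Y i t|).
  apply: le_trans (ler_wpM2l (sqrtr_ge0 _) khinchine).
  by rewrite mulr_sumr; apply: ler_sum => t _; exact: cs.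
have -> : 3 * #|I|%:R * (\sum_t `|\sum_i Y i t|) ^+ 2 =
    (Num.sqrt #|I|%:R * (Num.sqrt 3 * \sum_t `|\sum_i Y i t|)) ^+ 2.
  by rewrite !exprMn !sqr_sqrtr ?ler0n //; ring.
by rewrite ler_pXn2r // nnegrE ?mulr_ge0 ?sqrtr_ge0 ?sumr_ge0 // => t _;
  rewrite sumr_ge0.
Qed.
End Khinchine.

(** * Averages over permutations *)

(** Induction: a permutation correct on the tails is corrected at the head by a transposition that
    fixes all the tail images. *)
Lemma perm_map_uniq (T : finType) (s t : seq T) :
  size s = size t -> uniq s -> uniq t -> exists k : {perm T}, map k s = t.
Proof.
elim: s t => [|x s IHs] [|y t] //=; first by exists 1%g.
case=> /IHs {}IHs /andP[xNs /IHs {}IHs] /andP[yNt /IHs[k kE]].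
exists (k * tperm (k x) y)%g; rewrite permM tpermL; congr (_ :: _).
rewrite -[in RHS]kE; apply/eq_in_map => z zs; rewrite permM tpermD //.
  by rewrite (inj_eq perm_inj); apply: contraNneq xNs => ->.
by apply: contraNneq yNt => ->; rewrite -kE map_f.
Qed.

(** Double counting of the sum over [k] and over [t] in [A]: by transitivity the sum over [k] does
    not depend on [t], and by bijectivity the sum over [t] does not depend on [k]. Listing points by
    [code] covers vertices, pairs, triples and quadruples at once. *)
Lemma sum_perm_orbit (R : numFieldType) (S T : finType) (code : T -> seq S)
    (act : {perm S} -> T -> T) (A : {set T}) (z : T) (g : T -> R) :
  injective code -> (forall k t, code (act k t) = map k (code t)) ->
  (forall t, (t \in A) = uniq (code t)) ->
  (forall t, size (code t) = size (code z)) -> z \in A ->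
  \sum_(k : {perm S}) g (act k z) =
  #|{perm S}|%:R / #|A|%:R * \sum_(t in A) g t.
Proof.
move=> code_inj code_act A_uniq code_size zA.
have actM k l t : act (k * l)%g t = act l (act k t).
  apply: code_inj; rewrite !code_act -map_comp.
  by apply: eq_map => x; rewrite permM.
have act_inj k : injective (act k).
  move=> t1 t2 /(congr1 code); rewrite !code_act => /(inj_map perm_inj).
  exact: code_inj.
have sum_inv k : \sum_(t in A) g (act k t) = \sum_(t in A) g t.
  rewrite [RHS](reindex_inj (act_inj k)); apply: eq_bigl => t.
  by rewrite !A_uniq code_act (map_inj_uniq perm_inj).
have A0 : #|A|%:R != 0 :> R.
  by rewrite pnatr_eq0 -lt0n; apply/card_gt0P; exists z.
apply: (mulIf A0); rewrite mulrAC divfK //.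
transitivity (\sum_(t in A) \sum_(k : {perm S}) g (act k t)); last first.
  rewrite exchange_big; under eq_bigr do rewrite sum_inv.
  by rewrite sumr_const cardT -cardE mulr_natl.
rewrite mulr_natr -sumr_const; apply: eq_bigr => t tA.
have [l lE] : exists l : {perm S}, map l (code z) = code t.
  by apply: perm_map_uniq; rewrite ?code_size -?A_uniq.
have -> : t = act l z by apply: code_inj; rewrite code_act lE.
rewrite (reindex_inj (mulgI l)).
by apply: eq_bigr => k _; rewrite actM.
Qed.


Lemma sum_setX (R : nmodType) (T : finType) (A : {set T}) (f : T * T -> R) :
  \sum_(z in setX A A) f z = \sum_(x in A) \sum_(y in A) f (x, y).
Proof.
by rewrite pair_big_dep; apply: eq_big => [[x y]|[x y] _] //=; rewrite in_setX.
Qed.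

Local Notation total := Defs.total.

(** * The centred overlap and its conditional means *)

Section Excess.
Variables (R : realType) (n : nat).
Implicit Types w u : weight R n.

Local Notation M := (#|{perm 'I_n}|%:R : R).

Lemma out_sum_const (c : R) (x : 'I_n) : out_sum (fun _ _ => c) x = c * (n%:R - 1).
Proof.
rewrite /out_sum; have : \sum_(y < n) c = c * n%:R.
  by rewrite sumr_const card_ord mulr_natr.
by rewrite (bigD1 x) //= => /(canRL (addKr _)) ->; ring.
Qed.

Lemma total_out_sum w : total w = \sum_x out_sum w x.
Proof. by []. Qed.

Lemma total_in_sum w : total w = \sum_x in_sum w x.
Proof.
rewrite /total (exchange_big_dep predT) //=; apply: eq_bigr => x _.
by apply: eq_bigl => y; rewrite eq_sym.
Qed.

Lemma total_const (c : R) : total (fun _ _ : 'I_n => c) = c * (n%:R * (n%:R - 1)).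
Proof.
rewrite total_out_sum; under eq_bigr do rewrite out_sum_const.
by rewrite sumr_const card_ord -mulr_natr; ring.
Qed.

Lemma total_split w a : total w = out_sum w a + in_sum w a +
  \sum_(x | x != a) \sum_(y | (y != x) && (y != a)) w x y.
Proof.
rewrite /total (bigD1 a) //= -addrA; congr (_ + _).
rewrite /in_sum -big_split; apply: eq_bigr => x xNa /=.
by rewrite (bigD1 a) //= eq_sym.
Qed.

Lemma card_perm_gt0 : 0 < M.
Proof. by rewrite ltr0n; apply/card_gt0P; exists 1%g. Qed.

Hypothesis n_gt2 : (2 < n)%N.

Let n0 : n%:R != 0 :> R.
Proof. by rewrite pnatr_eq0; case: n n_gt2. Qed.

Let n1 : n%:R - 1 != 0 :> R.
Proof. by rewrite subr_eq0 (eqr_nat R n 1); case: n n_gt2 => [|[]]. Qed.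

Let n2 : n%:R - 2 != 0 :> R.
Proof. by rewrite subr_eq0 (eqr_nat R n 2); case: n n_gt2 => [|[|[]]]. Qed.

Lemma sum_perm1 (g : 'I_n -> R) a :
  \sum_(s : {perm 'I_n}) g (s a) = M / n%:R * \sum_x g x.
Proof.
have := @sum_perm_orbit R _ _ (fun x => [:: x]) (fun s x => s x) setT a g.
rewrite cardsT card_ord => -> //; first by under eq_bigl do rewrite inE.
- by move=> x y [].
- by move=> x; rewrite inE.
Qed.

Lemma sum_pairsE (g : 'I_n -> 'I_n -> R) :
  \sum_(e in distinct_pairs n) g e.1 e.2 = total g.
Proof.
by rewrite /total pair_big_dep; apply: eq_bigl => e; rewrite inE eq_sym.
Qed.

Lemma card_distinct_pairs : #|distinct_pairs n|%:R = n%:R * (n%:R - 1) :> R.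
Proof. by rewrite -sumr_const (sum_pairsE (fun _ _ => 1)) total_const mul1r. Qed.

Lemma sum_perm2 (g : 'I_n -> 'I_n -> R) a b : a != b ->
  \sum_(s : {perm 'I_n}) g (s a) (s b) = M / (n%:R * (n%:R - 1)) * total g.
Proof.
move=> ab.
have := @sum_perm_orbit R _ _ (fun e => [:: e.1; e.2])
  (fun s e => (s e.1, s e.2)) (distinct_pairs n) (a, b) (fun e => g e.1 e.2).
rewrite card_distinct_pairs sum_pairsE; apply => //.
- by move=> [x y] [x' y'] [-> ->].
- by move=> t; rewrite inE /= inE andbT.
- by rewrite inE.
Qed.

Lemma sum_perm3 (g : 'I_n -> 'I_n -> 'I_n -> R) a b c : uniq [:: a; b; c] ->
  \sum_(s : {perm 'I_n}) g (s a) (s b) (s c) =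
  M / (n%:R * (n%:R - 1) * (n%:R - 2)) *
  \sum_x \sum_(y | y != x) \sum_(z | (z != y) && (z != x)) g x y z.
Proof.
move=> abc; pose A := [set t : 'I_n * 'I_n * 'I_n | uniq [:: t.1.1; t.1.2; t.2]].
have sumA (h : 'I_n -> 'I_n -> 'I_n -> R) : \sum_(t in A) h t.1.1 t.1.2 t.2 =
    \sum_x \sum_(y | y != x) \sum_(z | (z != y) && (z != x)) h x y z.
  rewrite pair_big_dep pair_big_dep; apply: eq_bigl => t; rewrite !inE /= !inE.
  rewrite (eq_sym t.1.2 t.1.1) (eq_sym t.2 t.1.2) (eq_sym t.2 t.1.1).
  by do 3!case: (_ == _).
have := @sum_perm_orbit R _ _ (fun t => [:: t.1.1; t.1.2; t.2])
  (fun s t => (s t.1.1, s t.1.2, s t.2)) A (a, b, c) (fun t => g t.1.1 t.1.2 t.2).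
have -> : #|A|%:R = n%:R * (n%:R - 1) * (n%:R - 2) :> R.
  rewrite -sumr_const (sumA (fun _ _ _ => 1)).
  transitivity (\sum_(x < n) ((n%:R - 1) * (n%:R - 2)) : R); last first.
    by rewrite sumr_const card_ord -mulr_natl; ring.
  (* Counts the ordered pairs avoiding [x] as [n(n-1) - 2(n-1)]. *)
  apply: eq_bigr => x _; have := total_split (fun _ _ => 1) x.
  have -> : in_sum (fun _ _ => 1) x = out_sum (fun _ _ => 1) x :> R by [].
  by rewrite total_const out_sum_const => /esym/(canRL (addKr _)) ->; ring.
rewrite sumA; apply => //.
- by move=> [[x y] z] [[x' y'] z'] [-> -> ->].
- by move=> t; rewrite inE.
- by rewrite inE.
Qed.

(** The summation variables are positions, on which [o.1] and [o.2] place the vertices of [w] and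
    [u]. Two permutations make the images of a position independent, although the value depends only
    on [o.1^-1 * o.2]. *)
Definition excess w u (o : {perm 'I_n} * {perm 'I_n}) : R :=
  \sum_x \sum_(y | y != x)
    (w (o.1 x) (o.1 y) * u (o.2 x) (o.2 y) - density w * density u).

Lemma excess_pairing w u o : excess w u o =
  pairing (relabel (o.1^-1 * o.2)%g w) u - density w * density u * (n%:R * (n%:R - 1)).
Proof.
rewrite /excess -total_const /total /pairing.
rewrite [in X in _ = X - _](reindex_inj (@perm_inj _ o.2)) -sumrB.
apply: eq_bigr => x _; rewrite sumrB; congr (_ - _).
rewrite [RHS](reindex_inj (@perm_inj _ o.2)).
apply: eq_big => [y|y _]; first by rewrite (inj_eq perm_inj).
by rewrite /relabel invMg invgK !permM !permK.
Qed.

Lemma excess_range w u o : - disc_minus w u <= excess w u o <= disc_plus w u.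
Proof.
rewrite excess_pairing /disc_minus /disc_plus opprB lerD2r lerD2r.
by rewrite /min_pairing /max_pairing bigmin_le le_bigmax.
Qed.

Lemma sum_excess w u : \sum_o excess w u o = 0.
Proof.
rewrite /excess exchange_big big1 // => x _; rewrite exchange_big big1 // => y yx.
rewrite sumrB sumr_const.
rewrite -(pair_bigA _ (fun s r : {perm 'I_n} => w (s x) (s y) * u (r x) (r y))) /=.
rewrite -big_distrlr /= !sum_perm2 1?eq_sym // card_prod -[X in _ - X]mulr_natl natrM.
by rewrite /density; field; rewrite n0 n1.
Qed.

(** Conditioning on the images of [a]: once they are fixed to be [x] and [y], the two permutations
    remain independent. *)
Lemma sum_decouple (t : 'I_n -> 'I_n -> R) (f g : {perm 'I_n} -> R) a :
  \sum_(o : {perm 'I_n} * {perm 'I_n}) t (o.1 a) (o.2 a) * (f o.1 * g o.2) =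
  \sum_x \sum_y t x y * ((\sum_(s : {perm 'I_n}) (s a == x)%:R * f s) *
     (\sum_(s : {perm 'I_n}) (s a == y)%:R * g s)).
Proof.
rewrite -(pair_bigA _ (fun s r : {perm 'I_n} => t (s a) (r a) * (f s * g r))) /=.
transitivity (\sum_(s : {perm 'I_n}) \sum_(r : {perm 'I_n}) \sum_x \sum_y
   t x y * ((s a == x)%:R * f s * ((r a == y)%:R * g r))).
  apply: eq_bigr => s _; apply: eq_bigr => r _.
  rewrite (bigD1 (s a)) //= (bigD1 (r a)) //= !eqxx !mul1r.
  rewrite big1 => [|y ny]; last by rewrite (eq_sym (r a)) (negPf ny) mul0r !mulr0.
  rewrite addr0 big1 ?addr0 // => x nx; rewrite big1 // => y _.
  by rewrite (eq_sym (s a)) (negPf nx) !mul0r mulr0.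
under [LHS]eq_bigr do rewrite exchange_big.
rewrite exchange_big; apply: eq_bigr => x _.
under [LHS]eq_bigr do rewrite exchange_big.
rewrite exchange_big; apply: eq_bigr => y _.
rewrite big_distrlr /= mulr_sumr; apply: eq_bigr => s _.
by rewrite mulr_sumr.
Qed.

(* [<Psi^w x, Psi^u y>], where [Psi] has the coordinates of [Phi1] at a single
   vertex, with [p_coef] centred; [q_coef] already has mean zero. *)
Definition level1 w u x y : R :=
  2 * (n%:R - 2) / n%:R * ((p_coef w x - total w / (n%:R * (n%:R - 2))) *
    (p_coef u y - total u / (n%:R * (n%:R - 2)))) + 2 * (q_coef w x * q_coef u y).

Lemma sum_if1 (T : finType) (x : T) (g : T -> R) :
  \sum_y (y == x)%:R * g y = g x.
Proof.
rewrite (bigD1 x) //= eqxx mul1r big1 ?addr0 // => y /negPf ->.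
by rewrite mul0r.
Qed.

(** This lemma, [pinned_in] and [pinned_rest] give unnormalised conditional means given [s a = x],
    for the three ways in which a position pair can meet [a]. *)
Lemma pinned_out w a z x : z != a ->
  \sum_(s : {perm 'I_n}) (s a == x)%:R * w (s a) (s z) =
  M / (n%:R * (n%:R - 1)) * out_sum w x.
Proof.
move=> za; rewrite (sum_perm2 (fun p q => (p == x)%:R * w p q)) 1?eq_sym //.
congr (_ * _); rewrite /total; under eq_bigr do rewrite -mulr_sumr.
exact: (sum_if1 x (out_sum w)).
Qed.

Lemma pinned_in w a z x : z != a ->
  \sum_(s : {perm 'I_n}) (s a == x)%:R * w (s z) (s a) =
  M / (n%:R * (n%:R - 1)) * in_sum w x.
Proof. exact: (@pinned_out (fun p q => w q p)). Qed.

Lemma pinned_rest w a y z x : y != a -> z != a -> z != y ->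
  \sum_(s : {perm 'I_n}) (s a == x)%:R * w (s y) (s z) =
  M / (n%:R * (n%:R - 1) * (n%:R - 2)) * (total w - out_sum w x - in_sum w x).
Proof.
move=> ya za zy; rewrite (sum_perm3 (fun p q r => (p == x)%:R * w q r)); last first.
  by rewrite /= !inE negb_or (eq_sym a y) (eq_sym a z) (eq_sym y z) ya za zy.
congr (_ * _).
under eq_bigr => p _.
  under eq_bigr do rewrite -mulr_sumr.
  rewrite -mulr_sumr; over.
rewrite (sum_if1 x (fun p => \sum_(y | y != p) \sum_(z | (z != y) && (z != p)) w y z)).
by rewrite (total_split w x); ring.
Qed.

(** Position pairs are sorted by whether [a] comes first, second or not at all, and each class is
    evaluated by its pinned mean. *)
Lemma sum_excess_pinned w u (t : 'I_n -> 'I_n -> R) a :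
  \sum_(o : {perm 'I_n} * {perm 'I_n}) t (o.1 a) (o.2 a) * excess w u o =
  M ^+ 2 / (n%:R - 1) * \sum_x \sum_y t x y * level1 w u x y.
Proof.
have pinned1 x : \sum_(s : {perm 'I_n}) (s a == x)%:R * 1 = M / n%:R :> R.
  rewrite (sum_perm1 (fun p => (p == x)%:R * 1)).
  by rewrite (sum_if1 x (fun=> 1)) mulr1.
pose h z z' := \sum_x \sum_y t x y *
  ((\sum_(s : {perm 'I_n}) (s a == x)%:R * w (s z) (s z')) *
   (\sum_(s : {perm 'I_n}) (s a == y)%:R * u (s z) (s z')) -
   density w * density u * (M / n%:R) ^+ 2).
have -> : \sum_(o : {perm 'I_n} * {perm 'I_n}) t (o.1 a) (o.2 a) * excess w u o = total h.
  rewrite /excess; under eq_bigr do rewrite mulr_sumr.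
  rewrite exchange_big; apply: eq_bigr => z _.
  under eq_bigr do rewrite mulr_sumr.
  rewrite exchange_big; apply: eq_bigr => z' _.
  under eq_bigr do rewrite mulrBr.
  rewrite sumrB (sum_decouple t (fun s => w (s z) (s z')) (fun s => u (s z) (s z'))).
  have -> : \sum_(o : {perm 'I_n} * {perm 'I_n}) t (o.1 a) (o.2 a) *
       (density w * density u) = \sum_x \sum_y t x y *
       (density w * density u * (M / n%:R) ^+ 2).
    rewrite -mulr_suml.
    have := sum_decouple t (fun=> 1) (fun=> 1) a.
    under eq_bigr do rewrite mulr1 mulr1.
    move=> ->; rewrite mulr_suml; apply: eq_bigr => x _.
    rewrite mulr_suml; apply: eq_bigr => y _; rewrite !pinned1; ring.
  rewrite -sumrB; apply: eq_bigr => x _.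
  by rewrite -sumrB; apply: eq_bigr => y _; rewrite mulrBr.
pose F1 (fw fu : 'I_n -> R) (c : R) := \sum_x \sum_y t x y *
  (c ^+ 2 * (fw x * fu y) - density w * density u * (M / n%:R) ^+ 2).
pose rest (v : weight R n) x := total v - out_sum v x - in_sum v x.
pose K : R := M / (n%:R * (n%:R - 1)).
rewrite (total_split h a).
have -> : out_sum h a = (n%:R - 1) * F1 (out_sum w) (out_sum u) K.
  rewrite mulrC -(out_sum_const _ a); apply: eq_bigr => z za.
  apply: eq_bigr => x _; apply: eq_bigr => y _; rewrite !pinned_out //.
  by congr (_ * (_ - _)); rewrite -/K; ring.
have -> : in_sum h a = (n%:R - 1) * F1 (in_sum w) (in_sum u) K.
  rewrite mulrC -(out_sum_const _ a); apply: eq_bigr => z za.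
  apply: eq_bigr => x _; apply: eq_bigr => y _; rewrite !pinned_in //.
  by congr (_ * (_ - _)); rewrite -/K; ring.
have -> : \sum_(x | x != a) \sum_(y | (y != x) && (y != a)) h x y =
   (n%:R - 1) * (n%:R - 2) * F1 (rest w) (rest u) (K / (n%:R - 2)).
  transitivity (\sum_(x | x != a) \sum_(y | (y != x) && (y != a))
     F1 (rest w) (rest u) (K / (n%:R - 2))).
    apply: eq_bigr => z za; apply: eq_bigr => z' /andP[z'z z'a].
    apply: eq_bigr => x _; apply: eq_bigr => y _; rewrite !pinned_rest //.
    by congr (_ * (_ - _)); rewrite -/(rest w x) -/(rest u y) /K; field; rewrite n0 n1 n2.
  set c := F1 _ _ _; have := total_split (fun _ _ => c) a.
  have -> : in_sum (fun _ _ => c) a = out_sum (fun _ _ => c) a :> R by [].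
  by rewrite total_const out_sum_const => /esym/(canRL (addKr _)) ->; ring.
(* Row products plus column products diagonalise in [out_sum + in_sum] and [out_sum - in_sum], which
   yields the two coordinates of [level1]. *)
rewrite /F1 !mulr_sumr -!big_split /=; apply: eq_bigr => x _.
rewrite !mulr_sumr -!big_split /=; apply: eq_bigr => y _.
rewrite /level1 /rest /K /p_coef /q_coef /density.
by field; rewrite n0 n1 n2.
Qed.

Lemma total_fst (h : 'I_n -> R) : total (fun x _ => h x) = (n%:R - 1) * \sum_x h x.
Proof.
by rewrite mulr_sumr; apply: eq_bigr => x _; rewrite mulrC -(out_sum_const _ x).
Qed.

Lemma total_snd (h : 'I_n -> R) : total (fun _ y => h y) = (n%:R - 1) * \sum_x h x.
Proof. by rewrite total_in_sum -total_fst. Qed.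

Lemma sum_level1 w u x : \sum_y level1 w u x y = 0.
Proof.
rewrite /level1 big_split /= -!mulr_sumr.
have -> : \sum_y (p_coef u y - total u / (n%:R * (n%:R - 2))) = 0.
  rewrite sumrB sumr_const card_ord /p_coef -mulr_suml big_split /=.
  rewrite -[\sum_y out_sum u y]/(total u) -total_in_sum -mulr_natl.
  by field; rewrite n0 n2.
have -> : \sum_y q_coef u y = 0.
  rewrite /q_coef -mulr_suml sumrB -[\sum_y out_sum u y]/(total u) -total_in_sum.
  by rewrite subrr mul0r.
by rewrite !mulr0 addr0.
Qed.

(** The centring of [p_coef] cancels in differences, so the inner product is a mixed second
    difference of [level1]. *)
Lemma dot_Phi1 w u e f : dot (Phi1 w e) (Phi1 u f) =
  level1 w u e.1 f.1 - level1 w u e.1 f.2 - level1 w u e.2 f.1 + level1 w u e.2 f.2.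
Proof.
rewrite /dot /Phi1 /level1 /=.
have s2 : Num.sqrt 2 ^+ 2 = 2 :> R by rewrite sqr_sqrtr.
have sK : Num.sqrt (2 * (n%:R - 2) / n%:R) ^+ 2 = 2 * (n%:R - 2) / n%:R :> R.
  rewrite sqr_sqrtr // !mulr_ge0 ?invr_ge0 ?ler0n // subr_ge0 (ler_nat R 2 n).
  exact: ltnW.
move: s2 sK; set r2 := Num.sqrt 2; set rK := Num.sqrt _ => s2 sK.
transitivity (rK ^+ 2 * ((p_coef w e.1 - p_coef w e.2) * (p_coef u f.1 - p_coef u f.2)) +
  r2 ^+ 2 * ((q_coef w e.1 - q_coef w e.2) * (q_coef u f.1 - q_coef u f.2))).
  by ring.
by rewrite s2 sK; ring.
Qed.

(** The triangle inequality on the four terms of [dot_Phi1]; either endpoint of a uniform pair is a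
    uniform vertex. *)
Lemma J1_le w u : J1 w u <= 4 / n%:R ^+ 2 * \sum_x \sum_y `|level1 w u x y|.
Proof.
set L := level1 w u.
rewrite /J1 /unif_mean cardsX natrM card_distinct_pairs sum_setX /=.
have n1p : 0 < n%:R - 1 :> R by rewrite subr_gt0 (ltr_nat R 1 n) ltnW.
have np : 0 < n%:R :> R by rewrite ltr0n (ltn_trans _ n_gt2).
rewrite ler_pdivrMr ?mulr_gt0 //.
have -> : 4 / n%:R ^+ 2 * (\sum_x \sum_y `|L x y|) *
   (n%:R * (n%:R - 1) * (n%:R * (n%:R - 1))) =
   2 * (n%:R - 1) * (2 * (n%:R - 1) * (\sum_x \sum_y `|L x y|)) :> R.
  by field.
have dbl (h : 'I_n -> R) :
    \sum_(e in distinct_pairs n) (h e.1 + h e.2) = 2 * (n%:R - 1) * \sum_x h x.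
  rewrite big_split /= (sum_pairsE (fun x _ => h x)) (sum_pairsE (fun _ y => h y)).
  by rewrite total_fst total_snd; ring.
rewrite -dbl mulr_sumr; apply: ler_sum => e _.
rewrite -big_split /= -dbl; apply: ler_sum => f _.
rewrite dot_Phi1 -/L.
have := ler_normD (L e.1 f.1 - L e.1 f.2 - L e.2 f.1) (L e.2 f.2).
have := ler_normB (L e.1 f.1 - L e.1 f.2) (L e.2 f.1).
have := ler_normB (L e.1 f.1) (L e.1 f.2); lra.
Qed.

Definition quad_act (s : {perm 'I_n}) (Q : quad n) : quad n :=
  ((s Q.1.1, s Q.1.2), (s Q.2.1, s Q.2.2)).

(** The images of one fixed quadruple under independent uniform permutations are independent uniform
    quadruples. *)
Lemma sum_dot_Phi2 w u Q : Q \in distinct_quads n ->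
  \sum_(o : {perm 'I_n} * {perm 'I_n})
    `|dot (Phi2 w (quad_act o.1 Q)) (Phi2 u (quad_act o.2 Q))| = M ^+ 2 * J2 w u.
Proof.
move=> QA.
have orb (g : quad n -> R) : \sum_(s : {perm 'I_n}) g (quad_act s Q) =
    M / #|distinct_quads n|%:R * \sum_(P in distinct_quads n) g P.
  have := @sum_perm_orbit R _ _ (fun P : quad n => [:: P.1.1; P.1.2; P.2.1; P.2.2])
    quad_act (distinct_quads n) Q g; apply => //.
    by move=> [[x y] [z t]] [[x' y'] [z' t']] [-> -> -> ->].
  by move=> P; rewrite inE.
rewrite -(pair_bigA _ (fun s r => `|dot (Phi2 w (quad_act s Q)) (Phi2 u (quad_act r Q))|)).
rewrite /= (orb (fun P => \sum_r `|dot (Phi2 w P) (Phi2 u (quad_act r Q))|)).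
under eq_bigr => P _ do rewrite (orb (fun P' => `|dot (Phi2 w P) (Phi2 u P')|)).
rewrite /J2 /unif_mean cardsX natrM sum_setX -mulr_sumr invfM /=; ring.
Qed.

Lemma dot_Phi2 w u P Q : dot (Phi2 w P) (Phi2 u Q) =
  (Cquad w P * Cquad u Q + Cquad w (quad_tr P) * Cquad u (quad_tr Q)) / 2.
Proof. by rewrite /dot /Phi2 /=; field. Qed.
End Excess.

(** * Swapping blocks of positions *)

Section Blocks.
Variables (R : realType) (n k : nat) (e : 'I_k * 'I_4 -> 'I_n).
Implicit Types w u : weight R n.
Hypothesis n_gt2 : (2 < n)%N.
Hypothesis k_gt0 : (0 < k)%N.
Hypothesis e_inj : injective e.
Local Notation M := (#|{perm 'I_n}|%:R : R).
Local Notation perm2 := ({perm 'I_n} * {perm 'I_n})%type.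

(** Block [i] supplies four positions: the tilt swaps [a i] with [b i], while swapping [c i] with
    [d i] provides the random signs for Khinchine's inequality. *)
Let a i := e (i, inord 0).
Let b i := e (i, inord 1).
Let c i := e (i, inord 2).
Let d i := e (i, inord 3).

Let eE := (inj_eq e_inj).

Let ordE (s t : nat) : (s < 4)%N -> (t < 4)%N -> (inord s == inord t :> 'I_4) = (s == t).
Proof. by move=> s4 t4; rewrite -val_eqE /= !inordK. Qed.

Let posE s t i j : (s < 4)%N -> (t < 4)%N ->
  (e (i, inord s) == e (j, inord t)) = (i == j) && (s == t).
Proof. by move=> s4 t4; rewrite eE xpair_eqE ordE. Qed.

(** Products of permutations act left factor first, so [p] moves positions before [o.2] is applied;
    [w] stays in place. *)
Definition flip (p : {perm 'I_n}) (o : perm2) : perm2 := (o.1, p * o.2)%g.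

Lemma flip_tpermK x y : involutive (flip (tperm x y)).
Proof. by move=> [s r]; rewrite /flip /= mulgA tperm2 mul1g. Qed.

Lemma flip_inj p : injective (flip p).
Proof. by move=> [s r] [s' r'] [-> /mulgI ->]. Qed.

Lemma ab_fixed x : exists i1, forall i, i != i1 -> tperm (a i) (b i) x = x.
Proof.
have [/existsP[i1 xi1]|/existsPn H] := boolP [exists i, (x == a i) || (x == b i)].
  exists i1 => i ii1; rewrite tpermD //; case/orP: xi1 => /eqP ->;
  by rewrite posE // (negPf ii1).
(* A position outside all the pairs is fixed by every swap, so any index will do. *)
exists (Ordinal k_gt0) => i _; have := H i; rewrite negb_or => /andP[h1 h2].
by rewrite tpermD // eq_sym.
Qed.

Lemma excess_quadratic_tilt w u (s : 'I_k -> perm2 -> R) :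
  (forall i o, s i (flip (tperm (a i) (b i)) o) = - s i o) ->
  (forall i j o, i != j -> s j (flip (tperm (a i) (b i)) o) = s j o) ->
  quadratic_tilt s (excess w u).
Proof.
move=> s_odd s_even; apply: quadratic_tilt_sum => x _.
apply: quadratic_tilt_sum => y _.
have [i1 H1] := ab_fixed x; have [i2 H2] := ab_fixed y.
apply: (@quadratic_tilt_local _ _ _ (fun i => flip (tperm (a i) (b i))) s _ _ _ _ i1 i2) => //.
  by move=> i; exact: flip_tpermK.
by move=> i o h1 h2; rewrite /= !permM H1 // H2.
Qed.

Lemma disc_tilt w u (s : 'I_k -> perm2 -> R) :
  (forall i o, s i (flip (tperm (a i) (b i)) o) = - s i o) ->
  (forall i j o, i != j -> s j (flip (tperm (a i) (b i)) o) = s j o) ->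
  (forall i o, `|s i o| <= 1) ->
  (\sum_o (\sum_i s i o) * excess w u o) ^+ 2 <=
    4 * (disc_plus w u * disc_minus w u) * (M ^+ 2) ^+ 2.
Proof.
move=> s_odd s_even s1.
have := @tilt_range R _ _ (fun i => flip (tperm (a i) (b i))) s _ _ _
  (excess w u) (disc_plus w u) (disc_minus w u).
rewrite card_prod natrM -expr2; apply => //.
- by move=> i; exact: flip_tpermK.
- exact: excess_quadratic_tilt.
- exact: sum_excess.
- by move=> o; exact: excess_range.
Qed.

Let n1 : n%:R - 1 != 0 :> R.
Proof. by rewrite subr_eq0 (eqr_nat R n 1); case: n n_gt2 => [|[]]. Qed.

(** Permuting positions in both coordinates preserves [excess], so all positions [z] other than [x]
    give the same value [Q z]. The sum of [Q] over all positions is zero because [level1] has zero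
    row sums. *)
Lemma sum_excess_pinned_ne w u (t : 'I_n -> 'I_n -> R) x y : x != y ->
  \sum_(o : perm2) t (o.1 x) (o.2 y) * excess w u o =
  - (n%:R - 1)^-1 * \sum_(o : perm2) t (o.1 x) (o.2 x) * excess w u o.
Proof.
move=> xy; pose Q z := \sum_(o : perm2) t (o.1 x) (o.2 z) * excess w u o.
have QE z : z != x -> Q z = Q y.
  move=> zx; pose p := tperm z y.
  have h_inj : injective (fun o : perm2 => (p * o.1, p * o.2)%g).
    by move=> [s r] [s' r'] [/mulgI -> /mulgI ->].
  rewrite /Q (reindex_inj h_inj); apply: eq_bigr => o _ /=.
  rewrite !permM tpermL tpermD // 1?eq_sym //; congr (_ * _).
  by rewrite !excess_pairing /= invMg !mulgA mulgKV.
have : \sum_z Q z = 0.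
  rewrite /Q exchange_big /=; under eq_bigr do rewrite -mulr_suml.
  transitivity (\sum_(o : perm2)
      (fun p _ => \sum_z t p z) (o.1 x) (o.2 x) * excess w u o).
    apply: eq_bigr => o _; congr (_ * _).
    by rewrite [RHS](reindex_inj (@perm_inj _ o.2)).
  rewrite (sum_excess_pinned n_gt2 w u (fun p _ => \sum_z t p z)) big1 ?mulr0 // => p _.
  by rewrite -mulr_sumr sum_level1 // mulr0.
rewrite (bigD1 x) //= => /eqP; rewrite addr_eq0 => /eqP QxE.
have := out_sum_const (Q y) x; rewrite /out_sum.
rewrite -(eq_bigr _ QE) => sE.
rewrite -/(Q x) -/(Q y) QxE sE; field.
by [].
Qed.

(** The two halves of [s i] correlate with [excess] in the ratio 1 to [- (n - 1)^-1], so their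
    difference reinforces the main term. *)
Lemma disc_J1 w u :
  n%:R ^+ 2 * k%:R ^+ 2 * J1 w u ^+ 2 <= 256 * (disc_plus w u * disc_minus w u).
Proof.
pose t x y := Num.sg (level1 w u x y).
pose s i (o : perm2) := (t (o.1 (a i)) (o.2 (a i)) - t (o.1 (a i)) (o.2 (b i))) / 2.
have t1 x y : `|t x y| <= 1 by rewrite normr_sg; case: (_ != 0).
have s1 i o : `|s i o| <= 1.
  rewrite /s normrM normfV (ger0_norm (_ : 0 <= 2)) // ler_pdivrMr //.
  have := t1 (o.1 (a i)) (o.2 (a i)); have := t1 (o.1 (a i)) (o.2 (b i)).
  have := ler_normB (t (o.1 (a i)) (o.2 (a i))) (t (o.1 (a i)) (o.2 (b i))); lra.
have s_odd i o : s i (flip (tperm (a i) (b i)) o) = - s i o.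
  by rewrite /s /flip /= !permM tpermL tpermR; field.
have s_even i j o : i != j -> s j (flip (tperm (a i) (b i)) o) = s j o.
  by move=> ij; rewrite /s /flip /= !permM !tpermD ?posE // (negPf ij).
have := disc_tilt w u s_odd s_even s1.
set S := \sum_x \sum_y `|level1 w u x y|.
have S0 : 0 <= S by apply: sumr_ge0 => x _; apply: sumr_ge0.
(* The factor is [(1 + 1/(n-1)) / (2(n-1)) = n / (2(n-1)^2)]. *)
have -> : \sum_o (\sum_i s i o) * excess w u o =
    k%:R * (n%:R / (2 * (n%:R - 1) ^+ 2) * S) * M ^+ 2.
  under eq_bigr do rewrite mulr_suml.
  rewrite exchange_big /=.
  rewrite (eq_bigr (fun=> n%:R / (2 * (n%:R - 1) ^+ 2) * S * M ^+ 2)); last first.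
    move=> i _; have ab : a i != b i by rewrite posE // andbF.
    transitivity (2^-1 * (\sum_(o : perm2) t (o.1 (a i)) (o.2 (a i)) * excess w u o
       - \sum_(o : perm2) t (o.1 (a i)) (o.2 (b i)) * excess w u o)).
      by rewrite -sumrB mulr_sumr; apply: eq_bigr => o _; rewrite /s; field.
    rewrite (sum_excess_pinned_ne w u t ab) (sum_excess_pinned n_gt2 w u t).
    have -> : \sum_x \sum_y t x y * level1 w u x y = S.
      by apply: eq_bigr => x _; apply: eq_bigr => y _; rewrite normrEsg.
    by field.
  by rewrite sumr_const card_ord -mulr_natl; ring.
rewrite exprMn ler_pM2r ?exprn_gt0 ?card_perm_gt0 // => H.
have J0 : 0 <= J1 w u.
  by rewrite /J1 /unif_mean divr_ge0 ?ler0n // sumr_ge0.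
have np : 0 < n%:R :> R by rewrite ltr0n (ltn_trans _ n_gt2).
have n1p : 0 < n%:R - 1 :> R by rewrite subr_gt0 (ltr_nat R 1 n) ltnW.
have JS : n%:R * J1 w u / 8 <= n%:R / (2 * (n%:R - 1) ^+ 2) * S.
  apply: (@le_trans _ _ (S / (2 * n%:R))).
    have := J1_le n_gt2 w u; rewrite -/S => J1S.
    have -> : S / (2 * n%:R) = n%:R * (4 / n%:R ^+ 2 * S) / 8.
      by field; rewrite gt_eqF.
    by rewrite ler_wpM2r ?invr_ge0 // ler_wpM2l // ltW.
  rewrite mulrC ler_wpM2r // ler_pdivlMr ?mulr_gt0 ?exprn_gt0 //.
  rewrite mulrC ler_pdivrMr ?mulr_gt0 //; nra.
have : (k%:R * (n%:R * J1 w u / 8)) ^+ 2 <=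
    (k%:R * (n%:R / (2 * (n%:R - 1) ^+ 2) * S)) ^+ 2.
  have J8 : 0 <= n%:R * J1 w u / 8 by rewrite divr_ge0 // mulr_ge0 // ler0n.
  have k0 : 0 <= k%:R :> R by rewrite ler0n.
  have S8 := le_trans J8 JS.
  by apply: lerXn2r; rewrite ?nnegrE ?ler_wpM2l // mulr_ge0.
lra.
Qed.

(** The product of all transpositions of [c j] and [d j], described by its action; one second
    difference then detects every [j]. *)
Lemma all_swap : exists p : {perm 'I_n},
  (forall j, p (c j) = d j /\ p (d j) = c j) /\
  (forall x, (forall j, x != c j /\ x != d j) -> p x = x).
Proof.
suff [p [H1 H2]] : exists p : {perm 'I_n},
    (forall j, j \in enum 'I_k -> p (c j) = d j /\ p (d j) = c j) /\
  (forall x, (forall j, j \in enum 'I_k -> x != c j /\ x != d j) -> p x = x).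
  by exists p; split=> [j|x Hx]; [apply: H1; rewrite mem_enum | apply: H2 => j _].
elim: (enum 'I_k) (enum_uniq 'I_k) => [_|i r IHr /= /andP[iNr /IHr [p [H1 H2]]]].
  by exists 1%g; split=> [//|x _]; rewrite perm1.
have pcd : p (c i) = c i /\ p (d i) = d i.
  by split; apply: H2 => j jr; rewrite !posE //= ?andbF ?andbT;
    split=> //; apply: contraNneq iNr => ->.
exists (tperm (c i) (d i) * p)%g; split=> [j|x Hx].
  rewrite !permM inE; case: eqVneq => [->|ji] /= jr.
    by rewrite tpermL tpermR; case: pcd.
  by rewrite !tpermD ?posE //= ?andbF // 1?eq_sym ?(negPf ji) //; exact: H1.
have [h1 h2] := Hx i (mem_head _ _).
rewrite permM tpermD 1?eq_sym //; apply: H2 => j jr; apply: Hx.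
by rewrite inE jr orbT.
Qed.

Let Q i j : quad n := ((a i, b i), (c j, d j)).

Let Y w u i j (o : perm2) : R :=
  dot (Phi2 w (quad_act o.1 (Q i j))) (Phi2 u (quad_act o.2 (Q i j))).

(** A position pair contributes only if one member is [a i] or [b i] and the other is some [c j] or
    [d j]. For each [j] the two orders give the products of [Cquad] on [Q i j] and on its transpose,
    whose sum is twice [Y]. *)
Lemma second_difference w u i (p : {perm 'I_n}) (o : perm2) :
  (forall j, p (c j) = d j /\ p (d j) = c j) ->
  (forall x, (forall j, x != c j /\ x != d j) -> p x = x) ->
  excess w u o - excess w u (flip (tperm (a i) (b i)) o) - excess w u (flip p o)
    + excess w u (flip p (flip (tperm (a i) (b i)) o)) = 2 * \sum_j Y w u i j o.
Proof.
move=> p_swap p_fix; set q := tperm _ _.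
have pa : p (a i) = a i by apply: p_fix => j; rewrite !posE // !andbF.
have pb : p (b i) = b i by apply: p_fix => j; rewrite !posE // !andbF.
have qfix x : x != a i -> x != b i -> q x = x.
  by move=> xa xb; rewrite tpermD // eq_sym.
have pNa x : x != a i -> p x != a i by move=> xa; rewrite -{1}pa (inj_eq perm_inj).
have pNb x : x != b i -> p x != b i by move=> xb; rewrite -{1}pb (inj_eq perm_inj).
pose W x y := w (o.1 x) (o.1 y); pose U x y := u (o.2 x) (o.2 y).
pose D x y := W x y *
  (U x y - U (q x) (q y) - U (p x) (p y) + U (q (p x)) (q (p y))).
have D_p x y : p x = x -> p y = y -> D x y = 0.
  by move=> px py; rewrite /D px py; ring.
have D_q x y : x != a i -> x != b i -> y != a i -> y != b i -> D x y = 0.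
  move=> xa xb ya yb; rewrite /D !(qfix x) // !(qfix y) //.
  by rewrite !(qfix (p x)) ?(qfix (p y)) ?pNa ?pNb //; ring.
(* Diagonal terms, absent from [excess], vanish and may be added, so both indices range freely
   below. *)
have D_diag x : D x x = 0.
  have [->|xa] := eqVneq x (a i); first exact: D_p.
  have [->|xb] := eqVneq x (b i); first exact: D_p.
  exact: D_q.
have ab : b i != a i by rewrite posE // andbF.
pose g y := D (a i) y + D (b i) y + (D y (a i) + D y (b i)).
transitivity (\sum_x \sum_y D x y).
  rewrite /excess -!sumrB -big_split; apply: eq_bigr => x _ /=.
  rewrite -!sumrB -big_split [RHS](bigD1 x) //= D_diag add0r.
  by apply: eq_bigr => y _; rewrite /D /W /U !permM; ring.
transitivity (\sum_y g y).
  have -> : \sum_y g y = \sum_y D (a i) y + \sum_y D (b i) y +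
      \sum_x (D x (a i) + D x (b i)) by rewrite !big_split.
  rewrite [LHS](bigD1 (a i)) //= [X in _ + X = _](bigD1 (b i)) //= addrA.
  congr (_ + _).
  rewrite [RHS](bigD1 (a i)) //= [X in _ = _ + X](bigD1 (b i)) //=.
  rewrite !D_p // !add0r; apply: eq_bigr => x /andP[xa xb].
  rewrite (bigD1 (a i)) //= (bigD1 (b i)) //= big1 ?addr0 // => y /andP[ya yb].
  exact: D_q.
pose f (r : 'I_k * bool) := if r.2 then d r.1 else c r.1.
have f_inj : injective f.
  move=> [j []] [l []] /eqP; rewrite /f /= posE //= ?andbF ?andbT // => /eqP -> //.
rewrite (sum_support_inj f_inj) => [|y yf].
  rewrite -(pair_bigA _ (fun j s => g (f (j, s)))) /= mulr_sumr.
  apply: eq_bigr => j _; rewrite big_bool /f /=.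
  have [pc pd] := p_swap j.
  have qc : q (c j) = c j by apply: qfix; rewrite posE // andbF.
  have qd : q (d j) = d j by apply: qfix; rewrite posE // andbF.
  rewrite /Y dot_Phi2 /Q /quad_act /quad_tr /Cquad /=.
  by rewrite /g /D pa pb pc pd qc qd !tpermL !tpermR /W /U; field.
have py : p y = y.
  by apply: p_fix => j; split; [exact: yf (j, false) | exact: yf (j, true)].
by rewrite /g !D_p // !addr0.
Qed.

(** Exchanging the two members of a pair negates [Cquad] on the quadruple and on its transpose; the
    other blocks are disjoint from the swap. *)
Lemma Y_flip_ab w u i l j o : Y w u l j (flip (tperm (a i) (b i)) o) =
  if i == l then - Y w u l j o else Y w u l j o.
Proof.
rewrite /Y /Q /quad_act /flip /= !permM.
rewrite (@tpermD _ _ _ (c j)) ?(@tpermD _ _ _ (d j)) ?posE ?andbF //.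
case: eqVneq => [<-|il].
  by rewrite tpermL tpermR !dot_Phi2 /quad_tr /Cquad /=; field.
by rewrite !tpermD // ?posE //= ?andbF // (negPf il).
Qed.

Lemma Y_flip_cd w u i l j o : Y w u i j (flip (tperm (c l) (d l)) o) =
  if l == j then - Y w u i j o else Y w u i j o.
Proof.
rewrite /Y /Q /quad_act /flip /= !permM.
rewrite (@tpermD _ _ _ (a i)) ?(@tpermD _ _ _ (b i)) ?posE ?andbF //.
case: eqVneq => [<-|lj].
  by rewrite tpermL tpermR !dot_Phi2 /quad_tr /Cquad /=; field.
by rewrite !tpermD // ?posE //= ?andbF // (negPf lj).
Qed.

Lemma disc_J2 w u : k%:R ^+ 3 * J2 w u ^+ 2 <= 48 * (disc_plus w u * disc_minus w u).
Proof.
have [p [p_swap p_fix]] := all_swap.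
pose X i o := \sum_j Y w u i j o.
pose s i (o : perm2) := Num.sg (X i o).
have X_ab i l o : X l (flip (tperm (a i) (b i)) o) = if i == l then - X l o else X l o.
  rewrite /X; under eq_bigr do rewrite Y_flip_ab.
  by case: ifP; rewrite ?sumrN.
have X_p i o : X i (flip p o) = - X i o.
  rewrite /X -sumrN; apply: eq_bigr => j _.
  have pa : p (a i) = a i by apply: p_fix => l; rewrite !posE // !andbF.
  have pb : p (b i) = b i by apply: p_fix => l; rewrite !posE // !andbF.
  have [pc pd] := p_swap j.
  by rewrite /Y !dot_Phi2 /= !permM pa pb pc pd; field.
have s1 i o : `|s i o| <= 1 by rewrite normr_sg; case: (_ != 0).
have s_odd i o : s i (flip (tperm (a i) (b i)) o) = - s i o.
  by rewrite /s X_ab eqxx sgrN.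
have s_even i j o : i != j -> s j (flip (tperm (a i) (b i)) o) = s j o.
  by move=> ij; rewrite /s X_ab (negPf ij).
have s_p i o : s i (flip p o) = - s i o by rewrite /s X_p sgrN.
(* The sign is odd under each of [q] and [p], so all four terms of the second difference contribute
   equally; hence [2 * E|X| = 4 * E(s * excess)]. *)
have corr i : \sum_o s i o * excess w u o = 2^-1 * \sum_o `|X i o|.
  set q := tperm (a i) (b i).
  have E1 : \sum_o s i o * excess w u (flip q o) = - \sum_o s i o * excess w u o.
    rewrite [in RHS](reindex_inj (@flip_inj q)) -sumrN.
    by apply: eq_bigr => o _; rewrite s_odd mulNr opprK.
  have E2 : \sum_o s i o * excess w u (flip p o) = - \sum_o s i o * excess w u o.
    rewrite [in RHS](reindex_inj (@flip_inj p)) -sumrN.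
    by apply: eq_bigr => o _; rewrite s_p mulNr opprK.
  have E3 : \sum_o s i o * excess w u (flip p (flip q o)) =
      \sum_o s i o * excess w u o.
    rewrite -[RHS]opprK -E2 [in RHS](reindex_inj (@flip_inj q)) -sumrN.
    by apply: eq_bigr => o _; rewrite s_odd mulNr opprK.
  have : \sum_o s i o * (2 * X i o) = 4 * \sum_o s i o * excess w u o.
    under eq_bigr => o _ do rewrite -(second_difference w u i o p_swap p_fix)
      mulrDr !mulrBr.
    by rewrite big_split /= !sumrB E1 E2 E3; ring.
  under eq_bigr do rewrite mulrCA -normrEsg.
  by rewrite -mulr_sumr; lra.
have J0 : 0 <= J2 w u.
  by rewrite /J2 /unif_mean divr_ge0 ?ler0n // sumr_ge0.
have kp : 0 < k%:R :> R by rewrite ltr0n.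
pose r := Num.sqrt (k%:R / 3) : R.
have r2 : r ^+ 2 = k%:R / 3 by rewrite sqr_sqrtr // divr_ge0 // ler0n.
have rJ : 0 <= r * J2 w u * M ^+ 2.
  by rewrite mulr_ge0 ?exprn_ge0 ?ler0n // mulr_ge0 // sqrtr_ge0.
(* Each [Y i j] has mean absolute value [J2], so [khinchine_l1] reads [(k J2)^2 <= 3 k (E|X|)^2],
   whence [r = sqrt (k / 3)]. *)
have lowX i : r * J2 w u * M ^+ 2 <= \sum_o `|X i o|.
  have := @khinchine_l1 R _ _ (fun l => flip (tperm (c l) (d l))) (Y w u i).
  rewrite card_ord exchange_big /=.
  have -> : \sum_j \sum_o `|Y w u i j o| = k%:R * (J2 w u * M ^+ 2).
    rewrite (eq_bigr (fun=> J2 w u * M ^+ 2)) ?sumr_const ?card_ord ?mulr_natl //.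
    move=> j _; rewrite mulrC -(sum_dot_Phi2 w u (Q := Q i j)) //.
    by rewrite inE /Q /= !inE !posE //= ?andbF.
  move=> H; have {}H : (k%:R * (J2 w u * M ^+ 2)) ^+ 2 <=
      3 * k%:R * (\sum_o `|X i o|) ^+ 2.
    apply: H => [l|l o|l j o lj]; first exact: flip_tpermK.
    - by rewrite Y_flip_cd eqxx.
    - by rewrite Y_flip_cd (negPf lj).
  have X0 : 0 <= \sum_o `|X i o| by apply: sumr_ge0.
  rewrite -ler_sqr ?nnegrE // -(ler_pM2l (mulr_gt0 (ltr0n R 3) kp)).
  apply: le_trans H; rewrite le_eqVlt; apply/orP; left; apply/eqP.
  have -> : (r * J2 w u * M ^+ 2) ^+ 2 = k%:R / 3 * (J2 w u * M ^+ 2) ^+ 2.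
    by rewrite -r2; ring.
  by field.
have := disc_tilt w u s_odd s_even s1.
have -> : \sum_o (\sum_i s i o) * excess w u o = 2^-1 * \sum_i \sum_o `|X i o|.
  under eq_bigr do rewrite mulr_suml.
  rewrite exchange_big mulr_sumr /=; apply: eq_bigr => i _; exact: corr.
have low : k%:R * (r * J2 w u * M ^+ 2) <= \sum_i \sum_o `|X i o|.
  have -> : k%:R * (r * J2 w u * M ^+ 2) = \sum_(i < k) (r * J2 w u * M ^+ 2).
    by rewrite sumr_const card_ord mulr_natl.
  by apply: ler_sum => i _.
move=> H; have {}H : (2^-1 * (k%:R * (r * J2 w u * M ^+ 2))) ^+ 2 <=
    4 * (disc_plus w u * disc_minus w u) * (M ^+ 2) ^+ 2.
  apply: le_trans H; apply: lerXn2r; rewrite ?nnegrE.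
  - by rewrite mulr_ge0 ?invr_ge0 // mulr_ge0 // ltW.
  - by rewrite mulr_ge0 ?invr_ge0 //; apply: sumr_ge0 => i _; apply: sumr_ge0.
  - by rewrite ler_wpM2l ?invr_ge0.
rewrite -(ler_pM2r (exprn_gt0 2 (exprn_gt0 2 (card_perm_gt0 R n)))).
have E : (2^-1 * (k%:R * (r * J2 w u * M ^+ 2))) ^+ 2 =
    k%:R ^+ 3 * J2 w u ^+ 2 * (M ^+ 2) ^+ 2 / 12.
  transitivity (k%:R ^+ 2 * (r ^+ 2) * J2 w u ^+ 2 * (M ^+ 2) ^+ 2 / 4).
    by field.
  by rewrite r2; field.
by rewrite E in H; lra.
Qed.
End Blocks.

(** * Choice of the blocks and the final constants *)

Lemma disc_ge0 (R : realType) (n : nat) (w u : weight R n) : (2 < n)%N ->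
  0 <= disc_plus w u /\ 0 <= disc_minus w u.
Proof.
move=> n_gt2; have M0 : 0 < #|{: {perm 'I_n} * {perm 'I_n}}|%:R :> R.
  by rewrite ltr0n; apply/card_gt0P; exists (1, 1)%g.
have sum_const (x : R) : \sum_(o : {perm 'I_n} * {perm 'I_n}) x =
    #|{: {perm 'I_n} * {perm 'I_n}}|%:R * x by rewrite sumr_const mulr_natl.
have [E r] := (sum_excess n_gt2 w u, excess_range w u).
split; rewrite -(pmulr_rge0 _ M0) -sum_const.
  by rewrite -[leLHS]E; apply: ler_sum => o _; case/andP: (r o).
by rewrite -oppr_le0 -sumrN -[leRHS]E; apply: ler_sum => o _; case/andP: (r o).
Qed.

Lemma disc_prod_ge (R : realType) (n : nat) (w u : weight R n) : (4 <= n)%N ->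
  n%:R ^+ 4 * J1 w u ^+ 2 + n%:R ^+ 3 * J2 w u ^+ 2 <=
    200 * 200 * (disc_plus w u * disc_minus w u).
Proof.
move=> n4; have n_gt2 : (2 < n)%N by apply: leq_trans n4.
set k := (n %/ 4)%N; have k_gt0 : (0 < k)%N by rewrite divn_gt0.
(* Here [n = 4 k + r] with [r <= 3 <= 3 k], as [k] is positive. *)
have n7k : n%:R <= 7 * k%:R :> R.
  rewrite -natrM ler_nat {1}(divn_eq n 4) -/k.
  have : (n %% 4 <= 3)%N by rewrite -ltnS ltn_mod.
  move=> /leq_trans h; rewrite (_ : 7 * k = k * 4 + 3 * k)%N ?leq_add2l ?h //.
    by rewrite leq_pmulr.
  by rewrite (mulnC k) -mulnDl.
have le_card : (#|{: 'I_k * 'I_4}| <= n)%N.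
  by rewrite card_prod !card_ord leq_trunc_div.
pose e (x : 'I_k * 'I_4) : 'I_n := widen_ord le_card (enum_rank x).
have e_inj : injective e.
  by move=> x y /(congr1 val) /= /val_inj /enum_rank_inj.
have np : 0 <= n%:R :> R by [].
have := disc_J1 n_gt2 k_gt0 e_inj w u; have := disc_J2 n_gt2 k_gt0 e_inj w u.
set P := _ * disc_minus _ _ => H2 H1.
have E1 : n%:R ^+ 4 * J1 w u ^+ 2 <= 49 * (n%:R ^+ 2 * k%:R ^+ 2 * J1 w u ^+ 2).
  have -> : 49 * (n%:R ^+ 2 * k%:R ^+ 2 * J1 w u ^+ 2) =
    (n%:R ^+ 2 * (7 * k%:R) ^+ 2) * J1 w u ^+ 2 by ring.
  rewrite ler_wpM2r ?sqr_ge0 // (exprD _ 2 2) ler_wpM2l ?sqr_ge0 //.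
  by rewrite lerXn2r // nnegrE (le_trans np).
have E2 : n%:R ^+ 3 * J2 w u ^+ 2 <= 343 * (k%:R ^+ 3 * J2 w u ^+ 2).
  have -> : 343 * (k%:R ^+ 3 * J2 w u ^+ 2) = (7 * k%:R) ^+ 3 * J2 w u ^+ 2 by ring.
  by rewrite ler_wpM2r ?sqr_ge0 // lerXn2r // nnegrE (le_trans np).
(* With [H2] this makes [P] nonnegative, so that [49 * 256 + 343 * 48 = 29008] may be rounded up to
   [200 * 200]. *)
have : 0 <= k%:R ^+ 3 * J2 w u ^+ 2 by rewrite mulr_ge0 ?sqr_ge0 // exprn_ge0.
lra.
Qed.

Theorem theorem1p7 (R : realType) :
  exists c : R, 0 < c /\
    forall n : nat, (4 <= n)%N -> forall w u : weight R n,
      c * (n%:R ^+ 4 * J1 w u ^+ 2 + n%:R ^+ 3 * J2 w u ^+ 2)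
        <= disc_plus w u * disc_minus w u
      /\ c * (n%:R ^+ 2 * J1 w u + powR n%:R (3 / 2) * J2 w u) <= disc w u.
Proof.
exists (200 * 200)^-1; split; first by rewrite invr_gt0 mulr_gt0.
move=> n n4 w u; have n_gt2 : (2 < n)%N by apply: leq_trans n4.
have [dp dm] := disc_ge0 w u n_gt2; have H := disc_prod_ge w u n4.
have D0 := mulr_ge0 dp dm.
rewrite !(mulrC (200 * 200)^-1) !ler_pdivrMr ?mulr_gt0 //; split; first lra.
set N := powR _ _.
have N2 : N ^+ 2 = n%:R ^+ 3.
  rewrite -[LHS]powR_mulrn ?powR_ge0 // -powRrM -powR_mulrn //.
  by congr (powR _ _); field.
have dpd : disc_plus w u <= disc w u by rewrite /disc le_max lexx.
have dmd : disc_minus w u <= disc w u by rewrite /disc le_max lexx orbT.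
have d0 : 0 <= disc w u := le_trans dp dpd.
have Dd : disc_plus w u * disc_minus w u <= disc w u ^+ 2 by exact: ler_pM.
have C0 : 0 <= disc w u * (200 * 200) by rewrite mulr_ge0 // mulr_ge0.
(* Squaring below requires a nonnegative left side. It then suffices that
   [(x + y)^2 <= 2 (x^2 + y^2)], the factor 2 being absorbed because the constant [200 * 200] gets
   squared. *)
have [neg|pos] := ltP (n%:R ^+ 2 * J1 w u + N * J2 w u) 0.
  exact: le_trans (ltW neg) C0.
rewrite -ler_sqr ?nnegrE //.
have : 0 <= (n%:R ^+ 2 * J1 w u - N * J2 w u) ^+ 2 by exact: sqr_ge0.
have : (N * J2 w u) ^+ 2 = n%:R ^+ 3 * J2 w u ^+ 2 by rewrite exprMn N2.
have : (n%:R ^+ 2 * J1 w u) ^+ 2 = n%:R ^+ 4 * J1 w u ^+ 2 by ring.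
move: (n%:R ^+ 2 * J1 w u) (N * J2 w u) pos => x y pos Ex Ey.
rewrite sqrrB sqrrD exprMn Ex Ey => sq.
have : 0 <= disc w u ^+ 2 by exact: sqr_ge0.
lra.
Qed.
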